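(* Let $G = (V(G), E(G), \mathbf{s}, \mathbf{r})$ be a non-trivial directed graph and let $\Gamma = \Gamma(I(G))$ be the zero-divisor graph of $I(G)$. There are exactly three situations for the diameter and girth of $\Gamma$: (i) $(\mathrm{diam}(\Gamma), \mathrm{gr}(\Gamma)) = (1, \infty)$ if and only if $|E(G)| = 0$ and $|V(G)| = 2$; (ii) $(\mathrm{diam}(\Gamma), \mathrm{gr}(\Gamma)) = (1, 3)$ if and only if $|E(G)| = 0$ and $|V(G)| \ge 3$; (iii) $(\mathrm{diam}(\Gamma), \mathrm{gr}(\Gamma)) = (2, 3)$ if and only if $|E(G)| \ne 0$.
   Context: A directed graph $G=(V(G),E(G),\mathbf{s},\mathbf{r})$ has a non-empty vertex set $V(G)$, an edge set $E(G)$ (loops and multiple edges allowed), and source and range maps $\mathbf{s},\mathbf{r}:E(G)\to V(G)$. It is trivial if it consists of one isolated vertex (one vertex, no edges); non-trivial otherwise. $\mathrm{Path}(G)$ is the set of all finite directed paths $p=e_1\cdots e_n$ (with $\mathbf{r}(e_i)=\mathbf{s}(e_{i+1})$, $\mathbf{s}(p)=\mathbf{s}(e_1)$, $\mathbf{r}(p)=\mathbf{r}(e_n)$), including each vertex $v$ as an empty path with $\mathbf{s}(v)=\mathbf{r}(v)=v$; $p^{-1}=e_n^{-1}\cdots e_1^{-1}$ and $v^{-1}=v$. The graph inverse semigroup $I(G)$ is the semigroup with zero generated by $V(G)\cup E(G)\cup\{e^{-1}:e\in E(G)\}$ subject to, for $u,v\in V(G)$, $e,f\in E(G)$: $uv=\delta_{u,v}u$;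 $\mathbf{s}(e)e=e\mathbf{r}(e)=e$; $\mathbf{r}(e)e^{-1}=e^{-1}\mathbf{s}(e)=e^{-1}$; $e^{-1}f=\delta_{e,f}\mathbf{r}(e)$. Every non-zero element is uniquely $pq^{-1}$ with $p,q\in\mathrm{Path}(G)$, $\mathbf{r}(p)=\mathbf{r}(q)$; $(pq^{-1})(rs^{-1})$ equals $pts^{-1}$ if $r=qt$, $p(st)^{-1}$ if $q=rt$ (for a possibly empty path $t$), and $0$ otherwise. $I(G)$ is an inverse semigroup with idempotents $pp^{-1}$ ($p\in\mathrm{Path}(G)$) and $0$. For an inverse semigroup $T$ with zero, the natural partial order is $a\le b$ iff $a=eb$ for some idempotent $e$; $\omega(a,b)=\{c\in T:c\le a \text{ and } c\le b\}$. The zero-divisor graph $\Gamma(T)$ is the simple undirected graph with vertex set $Z(T)^\times=\{a\in T\setminus\{0\}:\exists\,b\in T\setminus\{0\},\ \omega(a,b)=\{0\}\}$, where distinct vertices $a,b$ are adjacent iff $\omega(a,b)=\{0\}$. The distance between two distinct vertices is the length of a shortest path joining them ($\infty$ if there is none), and $\mathrm{diam}$ is the largest distance between pairs of distinct vertices. The girth $\mathrm{gr}$ is the length of a shortest cycle, or $\infty$ if there are no cycles. *)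

(* Defs.v *)
From HB Require Import structures.
From mathcomp Require Import all_boot.
From mathcomp Require Import boolp classical_sets functions cardinality.

Set Implicit Arguments.
Unset Strict Implicit.
Unset Printing Implicit Defensive.

Local Open Scope classical_set_scope.

(** * Directed graphs *)

Record digraph := Digraph {
  vertex : Type;
  edge : Type;
  src : edge -> vertex;
  rng : edge -> vertex;
  vertex_nonempty : inhabited vertex
}.

Definition trivial_digraph (G : digraph) : Prop :=
  ([set: vertex G] #= `I_1)%card /\ ([set: edge G] #= `I_0)%card.

(** * The graph inverse semigroup, by generators and relations *)

Section GraphInverseSemigroup.
Variable G : digraph.

Inductive gis_gen :=
| Gvertex of vertex G
| Gedge of edge G
| Gedge_inv of edge G.

Inductive gis_term :=
| Tzero
| Tgen of gis_gen
| Tmul of gis_term & gis_term.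

Local Notation "0" := Tzero.
Local Notation "x * y" := (Tmul x y).
Local Notation V v := (Tgen (Gvertex v)).
Local Notation E e := (Tgen (Gedge e)).
Local Notation Einv e := (Tgen (Gedge_inv e)).

(* [gis_cong] is the least congruence on terms that makes the quotient a
   semigroup with zero and contains the defining relations of I(G). *)
Inductive gis_cong : gis_term -> gis_term -> Prop :=
| cong_refl x : gis_cong x x
| cong_sym x y : gis_cong x y -> gis_cong y x
| cong_trans x y z : gis_cong x y -> gis_cong y z -> gis_cong x z
| cong_mul x x' y y' :
    gis_cong x x' -> gis_cong y y' -> gis_cong (x * y) (x' * y')
| cong_mulA x y z : gis_cong (x * (y * z)) (x * y * z)
| cong_mul0x x : gis_cong (0 * x) 0
| cong_mulx0 x : gis_cong (x * 0) 0
| cong_vv v : gis_cong (V v * V v) (V v)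
| cong_uv u v : u <> v -> gis_cong (V u * V v) 0
| cong_src_e e : gis_cong (V (src e) * E e) (E e)
| cong_e_rng e : gis_cong (E e * V (rng e)) (E e)
| cong_rng_einv e : gis_cong (V (rng e) * Einv e) (Einv e)
| cong_einv_src e : gis_cong (Einv e * V (src e)) (Einv e)
| cong_einv_e e : gis_cong (Einv e * E e) (V (rng e))
| cong_einv_f e f : e <> f -> gis_cong (Einv e * E f) 0.

HB.instance Definition _ := gen_eqMixin gis_term.
HB.instance Definition _ := gen_choiceMixin gis_term.

Definition gis_congb : rel gis_term := fun x y => `[< gis_cong x y >].

Lemma gis_congb_refl : reflexive gis_congb.
Proof. by move=> x; apply/asboolP/cong_refl. Qed.

Lemma gis_congb_sym : symmetric gis_congb.
Proof. by move=> x y; apply/asboolP/asboolP; apply: cong_sym. Qed.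

Lemma gis_congb_trans : transitive gis_congb.
Proof.
move=> y x z /asboolP xy /asboolP yz.
by apply/asboolP/(cong_trans xy yz).
Qed.

Canonical gis_cong_equiv :=
  EquivRel gis_congb gis_congb_refl gis_congb_sym gis_congb_trans.

Local Open Scope quotient_scope.

Definition gis := {eq_quot gis_cong_equiv}.

HB.instance Definition _ : EqQuotient gis_term gis_cong_equiv gis :=
  EqQuotient.on gis.
HB.instance Definition _ := Choice.on gis.

Definition gis_class (x : gis_term) : gis := \pi_gis x.

Lemma gis_classP x y : gis_class x = gis_class y <-> gis_cong x y.
Proof.
by split=> [/eqquotP/asboolP // | xy]; apply/eqquotP/asboolP.
Qed.

Definition gis0 : gis := gis_class Tzero.

Definition gis_mul (a b : gis) : gis := gis_class (Tmul (repr a) (repr b)).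

Lemma gis_repr_class x : gis_cong (repr (gis_class x)) x.
Proof. by apply/gis_classP; rewrite /gis_class reprK. Qed.

Lemma gis_mulE x y :
  gis_mul (gis_class x) (gis_class y) = gis_class (Tmul x y).
Proof. by apply/gis_classP/cong_mul; apply: gis_repr_class. Qed.

Lemma gis_mulA : associative gis_mul.
Proof.
move=> a b c; rewrite -[a]reprK -[b]reprK -[c]reprK -!/(gis_class _) !gis_mulE.
exact/gis_classP/cong_mulA.
Qed.

HB.instance Definition _ := isSemigroup.Build gis gis_mulA.

End GraphInverseSemigroup.

(** * Simple graphs, distance, diameter and girth *)

Record sgraph := SGraph {
  svertex : choiceType;
  adj : rel svertex;
  adj_sym : symmetric adj;
  adj_irrefl : irreflexive adj
}.

(* Elements of ℕ ∪ {∞}, with [None] for ∞. *)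
Definition enat := option nat.
Notation infty := (None : enat).
Notation fin n := (Some n%N : enat).

Definition enat_le (x y : enat) : bool :=
  match x, y with
  | _, None => true
  | None, Some _ => false
  | Some m, Some n => m <= n
  end.

(* The least element of [A], or ∞ if [A] is empty. *)
Definition enat_min (A : set nat) : enat :=
  match pselect (exists n, `[< A n >]) with
  | left ex_n => Some (ex_minn ex_n)
  | right _ => None
  end.

Section Metric.
Variable H : sgraph.

Definition is_spath (a b : svertex H) (p : seq (svertex H)) : bool :=
  [&& path (@adj H) a p, uniq (a :: p) & last a p == b].

(* [p] omits the starting vertex, so its size is the number of edges. *)
Definition dist (a b : svertex H) : enat :=
  enat_min [set n | exists2 p, is_spath a b p & size p = n].

(* The supremum in ℕ ∪ {∞} of the distances between distinct vertices, that is,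
   the largest such distance, or ∞ if these distances are unbounded; it is 0 by
   convention when there are no two distinct vertices. *)
Definition diam : enat :=
  enat_min [set n | forall a b, a != b -> enat_le (dist a b) (fin n)].

Definition girth : enat :=
  enat_min [set n | exists c : seq (svertex H),
    [/\ ucycle (@adj H) c, 3 <= size c & size c = n]].

End Metric.

(** * The zero-divisor graph of an inverse semigroup [T] with zero [z] *)

(* The definitions use only the product and the zero of [T]; [gis G] is
   registered above as a [semigroupType]. *)

Section ZeroDivisorGraph.
Variables (T : semigroupType) (z : T).

Local Open Scope group_scope.

Definition natural_le (a b : T) : Prop := exists2 e : T, e * e = e & a = e * b.

Definition omega (a b : T) : set T :=
  [set c | natural_le c a /\ natural_le c b].

Definition zero_divisors : set T :=
  [set a | a <> z /\ exists2 b, b <> z & omega a b = [set z]].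

Definition zd_adj : rel zero_divisors :=
  fun a b => (a != b) && `[< omega (val a) (val b) = [set z] >].

Lemma zd_adj_sym : symmetric zd_adj.
Proof.
have omegaC a b : omega a b = omega b a.
  by apply/seteqP; split=> c [? ?]; split.
by move=> a b; rewrite /zd_adj eq_sym omegaC.
Qed.

Lemma zd_adj_irrefl : irreflexive zd_adj.
Proof. by move=> a; rewrite /zd_adj eqxx. Qed.

Definition zero_divisor_graph : sgraph := SGraph zd_adj_sym zd_adj_irrefl.

End ZeroDivisorGraph.

(* Main.v *)
(* I(G) acts faithfully on the finite paths of G by partial injections: p q^-1
   sends q t to p t.  The natural order is inclusion of graphs of these
   injections, and the unique factorisation of paths shows that two graphs that
   meet are nested.  So omega a b = {0} iff a and b act by disjoint graphs, and
   two non-adjacent vertices a <= b of the zero-divisor graph share every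
   neighbour of b; hence the diameter is at most 2.  An edge e yields the
   triangle r(e), e, e^-1 and the non-adjacent pair e e^-1 <= s(e).  Without
   edges, the zero-divisor graph is complete on V(G) as soon as |V(G)| >= 2. *)

Require Import Defs.
From mathcomp Require Import all_boot.
From mathcomp Require Import boolp classical_sets functions cardinality.

Local Open Scope classical_set_scope.
Local Open Scope card_scope.

Set Implicit Arguments.
Unset Strict Implicit.
Unset Printing Implicit Defensive.

(** * Factorisation and cancellation for concatenated lists *)

Lemma cat_eq_cat (T : Type) (s1 s2 t1 t2 : seq T) :
  s1 ++ t1 = s2 ++ t2 ->
  (exists2 u, s1 = s2 ++ u & t2 = u ++ t1) \/
  (exists2 u, s2 = s1 ++ u & t1 = u ++ t2).
Proof.
elim: s1 s2 => [|x s1 IHs] [|y s2] /=.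
- by move=> ->; left; exists [::].
- by move=> ->; right; exists (y :: s2).
- by move=> <-; left; exists (x :: s1).
- by case=> <- /IHs [[u -> ->]|[u -> ->]]; [left | right]; exists u.
Qed.

Lemma cat_injr (T : Type) (s : seq T) : injective (cat s).
Proof. by elim: s => //= x s IHs s1 s2 [/IHs]. Qed.

Lemma cat_injl (T : Type) (s : seq T) : injective (cat^~ s).
Proof.
move=> s1 s2 /(congr1 rev); rewrite !rev_cat => /cat_injr; exact: (can_inj revK).
Qed.

(** * Distances and girth in simple graphs *)

Section SimpleGraphs.
Variable H : sgraph.
Implicit Types a b c : svertex H.

Lemma enat_minE (A : set nat) n :
  A n -> (forall m, A m -> n <= m) -> enat_min A = Some n.
Proof.
move=> An minA; rewrite /enat_min; case: pselect => [exA|[]]; last first.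
  by exists n; apply/asboolP.
congr Some; case: ex_minnP => m /asboolP Am lem.
by apply/eqP; rewrite eqn_leq minA // lem //; apply/asboolP.
Qed.

Lemma enat_min_infty (A : set nat) : (forall n, ~ A n) -> enat_min A = None.
Proof.
move=> A0; rewrite /enat_min; case: pselect => // exA.
by have [n /asboolP/A0] := exA.
Qed.

Lemma enat_min_leP (A : set nat) n :
  reflect (exists2 m, A m & m <= n) (enat_le (enat_min A) (Some n)).
Proof.
rewrite /enat_min; case: pselect => [exA|nA] /=.
  case: ex_minnP => m /asboolP Am lem; apply: (iffP idP) => [le_mn|[k Ak le_kn]].
    by exists m.
  by apply: leq_trans le_kn; apply: lem; apply/asboolP.
by constructor=> -[m Am _]; case: nA; exists m; apply/asboolP.
Qed.

Lemma adj_neq a b : adj a b -> a != b.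
Proof. by apply: contraTneq => ->; rewrite adj_irrefl. Qed.

Lemma dist_le1 a b : a != b -> enat_le (dist a b) (Some 1) = adj a b.
Proof.
move=> ab; apply/enat_min_leP/idP => [[_ [p /and3P[pth _ lst] <-] lep]|adj_ab].
  case: p pth lst lep => [|c [|? ?]] //=; first by rewrite (negbTE ab).
  by rewrite andbT => ac /eqP <-.
exists 1 => //; exists [:: b] => //.
by rewrite /is_spath /= adj_ab eqxx inE ab.
Qed.

Lemma dist_le2 a b c : a != b -> adj a c -> adj c b -> enat_le (dist a b) (Some 2).
Proof.
move=> ab ac cb; apply/enat_min_leP; exists 2 => //; exists [:: c; b] => //.
by rewrite /is_spath /= ac cb eqxx !inE negb_or ab !adj_neq.
Qed.

Lemma dist_gt0 a b : a != b -> ~~ enat_le (dist a b) (Some 0).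
Proof.
move=> ab; apply/enat_min_leP => -[_ [p /and3P[_ _ lst] <-]].
by case: p lst => //=; rewrite (negbTE ab).
Qed.

Lemma diamE n a b :
  (forall a b, a != b -> enat_le (dist a b) (Some n)) ->
  a != b -> (forall m, enat_le (dist a b) (Some m) -> n <= m) ->
  diam H = Some n.
Proof. by move=> ub ab lb; apply: enat_minE => // m; move/(_ a b ab)/lb. Qed.

Lemma diam_complete a b :
  a != b -> (forall a b, a != b -> adj a b) -> diam H = Some 1.
Proof.
move=> ab compl; apply: (diamE _ ab) => [c d cd|[|//]].
  by rewrite dist_le1 // compl.
by rewrite (negbTE (dist_gt0 ab)).
Qed.

Lemma diam2 a b :
    (forall a b, a != b -> ~~ adj a b -> exists2 c, adj a c & adj c b) ->
  a != b -> ~~ adj a b -> diam H = Some 2.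
Proof.
move=> common ab nab; apply: (diamE _ ab) => [c d cd|[|[|//]]].
- case: (boolP (adj c d)) => [adj_cd|/common]; last first.
    by move=> /(_ cd) [x cx xd]; apply: (dist_le2 cd cx).
  have: enat_le (dist c d) (Some 1) by rewrite dist_le1.
  move=> /enat_min_leP [m dm lem]; apply/enat_min_leP.
  by exists m => //; apply: leqW.
- by rewrite (negbTE (dist_gt0 ab)).
- by rewrite dist_le1 // (negbTE nab).
Qed.

Lemma girth3 a b c : adj a b -> adj b c -> adj c a -> girth H = Some 3.
Proof.
(* The lower bound 3 is part of the definition of [girth], so exhibiting the triangle is enough. *)
move=> ab bc ca; apply: enat_minE => [|m [s [_ + <-]]] //.
exists [:: a; b; c]; split=> //; rewrite /ucycle /= ab bc ca !inE negb_or.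
by rewrite !adj_neq // adj_sym.
Qed.

(** A cycle is duplicate-free of length at least 3, so its first three vertices are pairwise
    distinct. *)
Lemma girth_infty :
  (forall a b c, a != b -> b != c -> c != a -> False) -> girth H = None.
Proof.
move=> no3; apply: enat_min_infty => n [[|a [|b [|c s]]] [/andP[_ +] // _ _]].
rewrite /= !inE !negb_or => /and3P[/and3P[ab ac _] /andP[bc _] _].
by apply: (no3 a b c) => //; rewrite eq_sym.
Qed.

End SimpleGraphs.

(** * The action of I(G) on paths *)

Section Action.
Variable G : digraph.
Local Open Scope group_scope.
Implicit Types (u v w : vertex G) (e f : edge G) (p q r s l : seq (edge G)).
Implicit Types (a b c : gis G).

(* The path with edges [p] and final vertex [v]; the final vertex is kept apart
   because an empty list of edges does not determine it. *)
Definition gpath : Type := seq (edge G) * vertex G.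

Definition start p v : vertex G := if p is e :: _ then src e else v.

Fixpoint is_gpath p v : Prop :=
  if p is e :: p' then rng e = start p' v /\ is_gpath p' v else True.

Lemma start_cat p q v : start (p ++ q) v = start p (start q v).
Proof. by case: p. Qed.

Lemma is_gpath_cat p q v :
  is_gpath (p ++ q) v <-> is_gpath p (start q v) /\ is_gpath q v.
Proof.
by elim: p => [|e p IHp] /=; rewrite ?start_cat ?IHp; tauto.
Qed.

(* States are not required to be genuine paths: it is enough to check the one
   junction at which an edge is glued or removed. *)
Definition erel e (x y : gpath) : Prop :=
  start x.1 x.2 = rng e /\ y = (e :: x.1, x.2).

(** Terms act on the left, so the right factor of a product acts first. A vertex is a partial
    identity, an edge glues itself in front, and its inverse is the converse relation. *)
Fixpoint trel (t : gis_term G) (x y : gpath) : Prop :=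
  match t with
  | Tzero => False
  | Tgen (Gvertex u) => start x.1 x.2 = u /\ y = x
  | Tgen (Gedge e) => erel e x y
  | Tgen (Gedge_inv e) => erel e y x
  | Tmul t1 t2 => exists2 z, trel t2 x z & trel t1 z y
  end.

(** The action satisfies every defining relation of I(G), hence descends to the quotient. For
    [e <> f], a path just extended by [f] does not begin with [e], so the product of the inverse of
    [e] with [f] acts as the empty relation. *)
Lemma trel_cong t t' :
  gis_cong t t' -> forall x y, trel t x y <-> trel t' x y.
Proof.
elim=> {t t'} //=.
- by move=> t t' _ IH x y; rewrite IH.
- by move=> t1 t2 t3 _ IH1 _ IH2 x y; rewrite IH1 IH2.
- move=> t1 t1' t2 t2' _ IH1 _ IH2 x y.
  by split=> -[z /IH2 ? /IH1 ?]; exists z.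
- move=> t1 t2 t3 x y; split=> [[z [z' ? ?] ?]|[z ? [z' ? ?]]].
    by exists z' => //; exists z.
  by exists z' => //; exists z.
- by move=> t x y; split=> // -[].
- by move=> t x y; split=> // -[].
- move=> v x y; split=> [[z [? ->] [? ->]]|[? ->]] //.
  by exists x.
- by move=> u v uv x y; split=> // -[z [xv ->] [xu _]]; case: uv; rewrite -xu.
- move=> e x y; split=> [[z [? ->] [_ ->]]|[? ->]] //.
  by exists (e :: x.1, x.2).
- move=> e x y; split=> [[z [? ->] [_ ->]]|[? ->]] //.
  by exists x.
- move=> e x y; split=> [[z [? ->] [_ ->]]|[? ->]] //.
  by exists y.
- move=> e x y; split=> [[z [? ->] [_ ->]]|[? ->]] //.
  by exists (e :: y.1, y.2).
- move=> e [p v] [q w]; split=> [[z [/= ? ->] [/= _ [-> ->]]]|[? ->]] //.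
  by exists (e :: p, v).
- by move=> e f ef x y; split=> // -[z [_ ->] [_ [/esym/ef]]].
Qed.

Definition grel a : gpath -> gpath -> Prop := trel (repr a).

Lemma grel_class t x y : grel (gis_class t) x y <-> trel t x y.
Proof. exact/trel_cong/gis_repr_class. Qed.

Lemma grel_mul a b x y :
  grel (a * b) x y <-> exists2 z, grel b x z & grel a z y.
Proof. exact: (grel_class (Tmul (repr a) (repr b))). Qed.

Lemma grel0 x y : ~ grel (gis0 G) x y.
Proof. by move/grel_class. Qed.

(** * Normal forms *)

Definition gV v : gis G := gis_class (Tgen (Gvertex v)).
Definition gE e : gis G := gis_class (Tgen (Gedge e)).
Definition gI e : gis G := gis_class (Tgen (Gedge_inv e)).

(** This is the element p q^-1 with r(p) = r(q) = [v]. The inner fold multiplies on the right, so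
    that the edges of [q] appear inverted and in reverse order; the vertex in the middle covers
    empty paths. *)
Definition nf p v q : gis G :=
  foldr (fun e a => gE e * a) (foldr (fun e a => a * gI e) (gV v) q) p.

Lemma mul_class (t t' : gis_term G) :
  gis_class t * gis_class t' = gis_class (Tmul t t') :> gis G.
Proof. exact: gis_mulE. Qed.

Lemma gis_mul0 a : gis0 G * a = gis0 G.
Proof.
rewrite -[a]reprK [X in _ * X]/(gis_class _) mul_class.
exact/gis_classP/cong_mul0x.
Qed.

Lemma gis_mulr0 a : a * gis0 G = gis0 G.
Proof.
rewrite -[a]reprK [X in X * _]/(gis_class _) mul_class.
exact/gis_classP/cong_mulx0.
Qed.

Lemma gVV v : gV v * gV v = gV v.
Proof. by rewrite mul_class; apply/gis_classP/cong_vv. Qed.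

Lemma gV_neq u v : u <> v -> gV u * gV v = gis0 G.
Proof. by move=> uv; rewrite mul_class; apply/gis_classP/cong_uv. Qed.

Lemma gV_src e : gV (src e) * gE e = gE e.
Proof. by rewrite mul_class; apply/gis_classP/cong_src_e. Qed.

Lemma gE_rng e : gE e * gV (rng e) = gE e.
Proof. by rewrite mul_class; apply/gis_classP/cong_e_rng. Qed.

Lemma gV_rng e : gV (rng e) * gI e = gI e.
Proof. by rewrite mul_class; apply/gis_classP/cong_rng_einv. Qed.

Lemma gI_src e : gI e * gV (src e) = gI e.
Proof. by rewrite mul_class; apply/gis_classP/cong_einv_src. Qed.

Lemma gIE e : gI e * gE e = gV (rng e).
Proof. by rewrite mul_class; apply/gis_classP/cong_einv_e. Qed.

Lemma gIE_neq e f : e <> f -> gI e * gE f = gis0 G.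
Proof. by move=> ef; rewrite mul_class; apply/gis_classP/cong_einv_f. Qed.

Lemma mul_foldr_gI a b q :
  a * foldr (fun e x => x * gI e) b q = foldr (fun e x => x * gI e) (a * b) q.
Proof. by elim: q => //= e q <-; rewrite mulgA. Qed.

Lemma gV_nf p v q : gV (start p v) * nf p v q = nf p v q.
Proof.
case: p => [|e p]; last by rewrite /= mulgA gV_src.
by rewrite /nf /= mul_foldr_gI gVV.
Qed.

Lemma gV_nf_neq u p v q : u <> start p v -> gV u * nf p v q = gis0 G.
Proof. by move=> uv; rewrite -gV_nf mulgA gV_neq // gis_mul0. Qed.

Lemma gE_nf_neq e p v q : rng e <> start p v -> gE e * nf p v q = gis0 G.
Proof. by move=> ev; rewrite -gE_rng -mulgA gV_nf_neq // gis_mulr0. Qed.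

(** Since e^-1 q^-1 = (q e)^-1, the edge lands at the far end of [q]. *)
Lemma gI_nf e v q : src e = v -> gI e * nf [::] v q = nf [::] (rng e) (rcons q e).
Proof.
move=> <-; rewrite /nf /= mul_foldr_gI gI_src.
by rewrite -cats1 foldr_cat /= gV_rng.
Qed.

Lemma gI_nf_nil_neq e v q : src e <> v -> gI e * nf [::] v q = gis0 G.
Proof. by move=> ev; rewrite -gI_src -mulgA gV_nf_neq // gis_mulr0. Qed.

Definition normal a : Prop :=
  a = gis0 G \/
  exists p v q, [/\ is_gpath p v, is_gpath q v & a = nf p v q].

(** A generator on the left only meets the front of [p], or, for an inverse edge with [p] empty,
    extends [q] at its end. A mismatch at the junction gives zero. *)
Lemma normal_gen_mul g a : normal a -> normal (gis_class (Tgen g) * a).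
Proof.
case=> [->|[p [v [q [pv qv ->]]]]]; first by left; rewrite gis_mulr0.
case: g => [u|e|e].
- have [->|uv] := pselect (u = start p v); last by left; apply: gV_nf_neq.
  by right; exists p, v, q; split=> //; apply: gV_nf.
- have [ev|ev] := pselect (rng e = start p v); last by left; apply: gE_nf_neq.
  by right; exists (e :: p), v, q.
- case: p pv => [_|f p [fp pv]].
    have [ev|ev] := pselect (src e = v); last by left; apply: gI_nf_nil_neq.
    right; exists [::], (rng e), (rcons q e); split=> //; last exact: gI_nf.
    by rewrite -cats1; apply/is_gpath_cat; rewrite /= ev.
  rewrite [nf _ _ _]/(gE f * nf p v q) mulgA.
  have [->|ef] := pselect (e = f); last first.
    by left; rewrite [_ * gE f](gIE_neq ef) gis_mul0.
  by rewrite [_ * gE f]gIE fp gV_nf; right; exists p, v, q.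
Qed.

Lemma gisP a : normal a.
Proof.
rewrite -[a]reprK -/(gis_class _).
have mul_normal (t : gis_term G) b : normal b -> normal (gis_class t * b).
  elim: t b => [|g|t1 IH1 t2 IH2] b nb.
  - by left; apply: gis_mul0.
  - exact: normal_gen_mul.
  - by rewrite -mul_class -mulgA; apply/IH1/IH2.
elim: (repr a) => [|g|t1 IH1 t2 IH2].
- by left.
- case: g => [v|e|e]; right.
  + by exists [::], v, [::].
  + by exists [:: e], (rng e), [::]; split=> //; rewrite /nf /= gE_rng.
  + by exists [::], (rng e), [:: e]; split=> //; rewrite /nf /= gV_rng.
- by rewrite -mul_class; apply: mul_normal.
Qed.

(** The action strips [q] and glues [p] in front of the common tail [l]. The path hypotheses make
    all junctions inside [p] and [q] valid, which leaves only the condition that [l] starts at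
    [v]. *)
Lemma grel_nf p v q x y : is_gpath p v -> is_gpath q v ->
  grel (nf p v q) x y <->
  exists l w, [/\ start l w = v, x = (q ++ l, w) & y = (p ++ l, w)].
Proof.
move=> + qv; elim: p x y => [x y _|e p IHp x y [ep pv]].
  elim: q x y qv => [x y _|e q IHq x y [eq qv]].
    rewrite /nf /= /gV grel_class /=; split=> [[xv ->]|[l [w [lv -> ->]]]] //.
    by case: x xv => l w lv; exists l, w.
  rewrite [nf _ _ _]/(nf [::] v q * gI e) grel_mul; split.
    move=> [z /grel_class[_ ->] /IHq-/(_ qv)[l [w [lv -> ->]]]].
    by exists l, w.
  move=> [l [w [lv -> ->]]]; exists (q ++ l, w); last first.
    by apply/IHq => //; exists l, w.
  by apply/grel_class; split=> //=; rewrite start_cat lv.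
rewrite [nf _ _ _]/(gE e * nf p v q) grel_mul; split.
  move=> [z /IHp-/(_ pv)[l [w [lv -> ->]]] /grel_class[_ ->]].
  by exists l, w.
move=> [l [w [lv -> ->]]]; exists (p ++ l, w); first by apply/IHp => //; exists l, w.
by apply/grel_class; split=> //=; rewrite start_cat lv.
Qed.

(** * The natural order and the sets omega *)

Lemma grel_nonzero a : a <> gis0 G -> exists x y, grel a x y.
Proof.
case: (gisP a) => // -[p [v [q [pv qv ->]]]] _.
(* The shortest pair of the graph, with empty tail: [q] is sent to [p]. *)
by exists (q ++ [::], v), (p ++ [::], v); apply/grel_nf => //; exists [::], v.
Qed.

Lemma grel_fun a x y z : grel a x y -> grel a x z -> y = z.
Proof.
case: (gisP a) => [->/grel0 //|[p [v [q [pv qv ->]]]]].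
move=> /grel_nf-/(_ pv qv)[l [w [_ -> ->]]] /grel_nf-/(_ pv qv)[k [w' [_ + ->]]].
by case=> /cat_injr <- <-.
Qed.

Lemma grel_inj a x y z : grel a x z -> grel a y z -> x = y.
Proof.
case: (gisP a) => [->/grel0 //|[p [v [q [pv qv ->]]]]].
move=> /grel_nf-/(_ pv qv)[l [w [_ -> ->]]] /grel_nf-/(_ pv qv)[k [w' [_ -> +]]].
by case=> /cat_injr <- <-.
Qed.

Lemma grel_faithful a b : (forall x y, grel a x y <-> grel b x y) -> a = b.
Proof.
move=> ab.
have [a0|/grel_nonzero[x [y axy]]] := pselect (a = gis0 G).
  rewrite a0; apply: contrapT => /nesym/grel_nonzero[x [y /ab]].
  by rewrite a0 => /grel0.
have bxy := axy; move/ab in bxy; move: ab {axy bxy} (axy) (bxy).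
case: (gisP a) => [->? /grel0//|[p [v [q [pv qv ->]]]]].
case: (gisP b) => [->? _ /grel0//|[r [w [s [rw sw ->]]]]] ab _ _.
(* Exchanging the shortest pairs of both graphs shows that [q] extends [s] by [k] and that [s]
   extends [q]; hence [k] is empty and the two normal forms coincide. *)
have : grel (nf r w s) (q ++ [::], v) (p ++ [::], v).
  by apply/ab/grel_nf => //; exists [::], v.
move=> /grel_nf-/(_ rw sw)[k [w' [kw [qE w'E] [pE _]]]].
have : grel (nf p v q) (s ++ [::], w) (r ++ [::], w).
  by apply/ab/grel_nf => //; exists [::], w.
move=> /grel_nf-/(_ pv qv)[l [_ [_ [sE _] _]]].
rewrite -{}w'E !cats0 in kw qE pE sE.
have k0 : k = [::].
  by move: sE; rewrite qE -catA -[X in X = _]cats0 => /cat_injr; case: (k).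
by rewrite -kw qE pE k0 !cats0.
Qed.

Definition grel_sub a b : Prop := forall x y, grel a x y -> grel b x y.

(** If [x] goes to [y], idempotency and functionality make [y] go to [y]; injectivity then gives
    [x = y]. *)
Lemma idempotent_grel c : c * c = c -> forall x y, grel c x y -> x = y.
Proof.
move=> cc x y cxy; apply/esym; move: cxy (cxy); rewrite -{1}cc => /grel_mul.
move=> [z cxz czy] cxy; have yz := grel_fun cxy cxz.
by rewrite -yz in czy; apply: grel_inj czy cxy.
Qed.

Lemma natural_leP a b : natural_le a b <-> grel_sub a b.
Proof.
split=> [[c cc ->] x y /grel_mul[z bxz /(idempotent_grel cc) <- //]|ab].
case: (gisP a) ab => [-> _|[p [v [q [pv qv ->]]]] ab].
  by exists (gis0 G); rewrite gis_mul0.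
(* The idempotent p p^-1 is the identity on the image of [a], so it cuts [b] down to [a].
   Faithfulness turns both goals, idempotency first and then the factorisation of [a], into
   equalities of graphs. *)
exists (nf p v p); apply: grel_faithful => x y; rewrite grel_mul.
  rewrite grel_nf //; split=> [[z /grel_nf-/(_ pv pv)]|].
    by move=> [l [w [lv -> ->]]] /grel_nf-/(_ pv pv).
  move=> [l [w [lv -> ->]]]; exists (p ++ l, w); apply/grel_nf => //; by exists l, w.
split=> [axy|[z bxz /grel_nf-/(_ pv pv)[l [w [lv zE ->]]]]].
  exists y; first exact: ab.
  move: axy => /grel_nf-/(_ pv qv)[l [w [lv _ ->]]].
  by apply/grel_nf => //; exists l, w.
have alw : grel (nf p v q) (q ++ l, w) (p ++ l, w).
  by apply/grel_nf => //; exists l, w.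
by rewrite zE in bxz; rewrite (grel_inj bxz (ab _ _ alw)).
Qed.

(** A shared pair means q l = s k and p l = r k. One tail is a suffix of the other; if k = u l, then
    q = s u and p = r u, so the first graph lies in the second. The other case is symmetric. *)
Lemma grel_meet_nested a b x y :
  grel a x y -> grel b x y -> grel_sub a b \/ grel_sub b a.
Proof.
(* The sample tail [k] comes from the shared pair. It shows that [u] followed by any tail from [v]
   starts at [w]; for empty [u] this says [v = w]. *)
have nested p v q r w s (u k : seq (edge G)) z : is_gpath p v -> is_gpath q v ->
    is_gpath r w -> is_gpath s w -> q = s ++ u -> p = r ++ u ->
    start k z = v -> start (u ++ k) z = w -> grel_sub (nf p v q) (nf r w s).
  move=> pv qv rw sw qE pE kv ukw x' y'.
  move=> /grel_nf-/(_ pv qv)[l [t [lv -> ->]]]; apply/grel_nf => //.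
  exists (u ++ l), t; split; rewrite ?qE ?pE ?catA //.
  by rewrite start_cat lv -kv -start_cat.
case: (gisP a) => [->/grel0 //|[p [v [q [pv qv ->]]]]].
case: (gisP b) => [->_ /grel0 //|[r [w [s [rw sw ->]]]]].
move=> /grel_nf-/(_ pv qv)[l [z [lv -> ->]]].
move=> /grel_nf-/(_ rw sw)[k [z' [kw [+ zE] [+ _]]]].
rewrite -{}zE in kw; move=> /cat_eq_cat[[u qE kE]|[u sE lE]].
  rewrite kE catA => /cat_injl pE; left; apply: (nested _ _ _ _ _ _ u l z) => //.
  by rewrite -kE.
rewrite lE catA => /esym/cat_injl rE; right; apply: (nested _ _ _ _ _ _ u k z) => //.
by rewrite -lE.
Qed.

Definition gdisjoint a b : Prop := forall x y, grel a x y -> ~ grel b x y.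

Lemma gdisjointC a b : gdisjoint a b -> gdisjoint b a.
Proof. by move=> ab x y bxy axy; apply: (ab x y). Qed.

(** If the graphs meet, they are nested, and the smaller element is a non-zero common lower bound.
    If they are disjoint, any common lower bound has an empty graph. *)
Lemma omegaP a b : omega a b = [set gis0 G] <-> gdisjoint a b.
Proof.
have nz0 c x y : grel c x y -> c <> gis0 G by move=> + c0; rewrite c0 => /grel0.
split=> [ab0 x y axy bxy|ab].
  have [ab|ba] := grel_meet_nested axy bxy.
    have: omega a b a by split; apply/natural_leP.
    by rewrite ab0 => /(nz0 _ _ _ axy).
  have: omega a b b by split; apply/natural_leP.
  by rewrite ab0 => /(nz0 _ _ _ bxy).
apply/seteqP; split=> [c [/natural_leP ca /natural_leP cb]|_ ->]; last first.
  by split; apply/natural_leP => x y /grel0.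
apply: contrapT => /grel_nonzero[x [y cxy]].
exact: (ab x y (ca _ _ cxy) (cb _ _ cxy)).
Qed.

Lemma gdisjoint_irrefl a : gdisjoint a a -> a = gis0 G.
Proof.
move=> aa; apply: contrapT => /grel_nonzero[x [y axy]].
exact: (aa x y).
Qed.

(** * The zero-divisor graph of I(G) *)

Local Notation Gamma := (zero_divisor_graph (gis0 G)).

(** Distinctness comes for free: an element disjoint from itself is zero, and vertices are
    non-zero. *)
Lemma adjP (a b : svertex Gamma) : adj a b <-> gdisjoint (val a) (val b).
Proof.
split=> [/andP[_ /asboolP/omegaP //]|ab]; apply/andP; split;
  last exact/asboolP/omegaP.
apply/eqP => abE; rewrite abE in ab.
by have [/(_ (gdisjoint_irrefl ab))] := set_valP b.
Qed.

Lemma zero_divisors_gdisjoint a b :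
  a <> gis0 G -> b <> gis0 G -> gdisjoint a b -> zero_divisors (gis0 G) a.
Proof. by move=> a0 b0 ab; split=> //; exists b => //; apply/omegaP. Qed.

Definition zdv a (za : zero_divisors (gis0 G) a) : svertex Gamma :=
  SigSub (mem_set za).

Lemma common_neighbour (a b : svertex Gamma) :
  a != b -> ~~ adj a b -> exists2 c, adj a c & adj c b.
Proof.
move=> _ /negP/adjP /existsNP[x /existsNP[y /not_implyP[axy /contrapT bxy]]].
(* Whatever witnesses that the larger element [d] is a zero divisor is also disjoint from [c]. *)
have zd (c d : svertex Gamma) : grel_sub (val c) (val d) ->
    exists2 c', adj c c' & adj c' d.
  move=> cd; have [d0 [c' c'0 /omegaP dc']] := set_valP d.
  exists (zdv (zero_divisors_gdisjoint c'0 d0 (gdisjointC dc'))).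
    by apply/adjP => u w /cd /dc'.
  by apply/adjP/gdisjointC.
have [/zd //|/zd[c bc ca]] := grel_meet_nested axy bxy.
by exists c; rewrite adj_sym.
Qed.

Lemma gV_nonzero v : gV v <> gis0 G.
Proof.
move=> v0; apply: (@grel0 ([::], v) ([::], v)).
by rewrite -v0; apply/grel_class.
Qed.

Lemma gE_nonzero e : gE e <> gis0 G.
Proof.
move=> e0; apply: (@grel0 ([::], rng e) ([:: e], rng e)).
by rewrite -e0; apply/grel_class.
Qed.

Lemma gI_nonzero e : gI e <> gis0 G.
Proof.
move=> e0; apply: (@grel0 ([:: e], rng e) ([::], rng e)).
by rewrite -e0; apply/grel_class.
Qed.

(** An edge, a vertex and an inverse edge change the length of a path by 1, 0 and -1. This separates
    their graphs, here and in the next two lemmas. *)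
Lemma gE_gdisjoint_gV e v : gdisjoint (gE e) (gV v).
Proof.
move=> [p w] y /grel_class[_ ->] /grel_class[_ [/(congr1 size)]] /=.
by move/eqP; rewrite -[X in _ == X]addn0 -addn1 eqn_add2l.
Qed.

Lemma gI_gdisjoint_gV e v : gdisjoint (gI e) (gV v).
Proof.
move=> x [p w] /grel_class[_ ->] /grel_class[_ [/(congr1 size)]] /=.
by move/eqP; rewrite -[X in X == _]addn0 -addn1 eqn_add2l.
Qed.

Lemma gE_gdisjoint_gI e f : gdisjoint (gE e) (gI f).
Proof.
move=> [p w] y /grel_class[_ ->] /grel_class[_ [/(congr1 size)]] /=.
by move/eqP; rewrite -[X in X == _]addn0 -addn2 eqn_add2l.
Qed.

Lemma gV_gdisjoint u v : u <> v -> gdisjoint (gV u) (gV v).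
Proof.
by move=> uv x y /grel_class[xu _] /grel_class[xv _]; apply: uv; rewrite -xu.
Qed.

Lemma diam_girth_edge (e : edge G) :
  (diam Gamma, girth Gamma) = (Some 2, Some 3).
Proof.
have EV v := @gE_gdisjoint_gV e v; have IV v := @gI_gdisjoint_gV e v.
pose zE := zdv (zero_divisors_gdisjoint (@gE_nonzero e)
  (@gV_nonzero (rng e)) (EV _)).
pose zI := zdv (zero_divisors_gdisjoint (@gI_nonzero e)
  (@gV_nonzero (rng e)) (IV _)).
pose zV v := zdv (zero_divisors_gdisjoint (@gV_nonzero v) (@gE_nonzero e)
  (gdisjointC (EV v))).
have eeI (x y : gpath) : grel (gE e * gI e) x y -> x = y.
  by move=> /grel_mul[z /grel_class[_ ->] /grel_class[_ ->]].
have eeI_e : grel (gE e * gI e) ([:: e], rng e) ([:: e], rng e).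
  by apply/grel_mul; exists ([::], rng e); apply/grel_class.
(* Again by length: e e^-1 fixes paths while [e] lengthens them, so e e^-1 is a vertex of the
   graph. *)
have eeE : gdisjoint (gE e * gI e) (gE e).
  move=> x y /eeI <- /grel_class[_]; case: x => p w [] /(congr1 size)/eqP /=.
  by rewrite -[X in X == _]addn0 -addn1 eqn_add2l.
have ee0 : gE e * gI e <> gis0 G by move=> e0; move: eeI_e; rewrite e0 => /grel0.
pose zee := zdv (zero_divisors_gdisjoint ee0 (@gE_nonzero e) eeE).
have eV_e : grel (gV (src e)) ([:: e], rng e) ([:: e], rng e) by apply/grel_class.
congr pair.
  (* Both elements fix the path [e], so they are not adjacent. They differ because only [src e]
     fixes the empty path there. *)
  apply: (@diam2 _ zee (zV (src e)) common_neighbour); last first.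
    by apply/negP => /adjP/(_ _ _ eeI_e).
  apply/eqP => /(congr1 val) /= eeV.
  have: grel (gV (src e)) ([::], src e) ([::], src e) by apply/grel_class.
  by rewrite -eeV => /grel_mul[z /grel_class[_]].
apply: (@girth3 _ zE zI (zV (rng e))).
- by apply/adjP; apply: gE_gdisjoint_gI.
- by apply/adjP; apply: IV.
- by apply/adjP; apply: gdisjointC; apply: EV.
Qed.

(** * Graphs without edges *)

Hypothesis no_edge : edge G -> False.

Lemma edgeless_vertex a : a <> gis0 G -> exists v, a = gV v.
Proof.
case: (gisP a) => [//|[p [v [q [_ _ ->]]]]] _.
case: p => [|e]; last by case: (no_edge e).
by case: q => [|e]; [exists v | case: (no_edge e)].
Qed.

Lemma edgeless_complete (a b : svertex Gamma) : a != b -> adj a b.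
Proof.
move=> ab; apply/adjP; have [a0 _] := set_valP a; have [b0 _] := set_valP b.
have [u aE] := edgeless_vertex a0; have [v bE] := edgeless_vertex b0.
rewrite aE bE; apply: gV_gdisjoint => uv; move/eqP: ab; apply.
by apply: val_inj; rewrite aE bE uv.
Qed.

Lemma edgeless_diam (u v : vertex G) : u <> v -> diam Gamma = Some 1%N.
Proof.
move=> uv; have vu := nesym uv.
pose zu := zdv (zero_divisors_gdisjoint (@gV_nonzero u) (@gV_nonzero v)
  (gV_gdisjoint uv)).
pose zv := zdv (zero_divisors_gdisjoint (@gV_nonzero v) (@gV_nonzero u)
  (gV_gdisjoint vu)).
apply: (@diam_complete _ zu zv _ edgeless_complete).
by apply: adj_neq; apply/adjP; apply: gV_gdisjoint.
Qed.

Lemma edgeless_girth3 (u v w : vertex G) :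
  u <> v -> v <> w -> w <> u -> girth Gamma = Some 3.
Proof.
move=> uv vw wu.
pose zu := zdv (zero_divisors_gdisjoint (@gV_nonzero u) (@gV_nonzero v)
  (gV_gdisjoint uv)).
pose zv := zdv (zero_divisors_gdisjoint (@gV_nonzero v) (@gV_nonzero w)
  (gV_gdisjoint vw)).
pose zw := zdv (zero_divisors_gdisjoint (@gV_nonzero w) (@gV_nonzero u)
  (gV_gdisjoint wu)).
by apply: (@girth3 _ zu zv zw); apply/adjP; apply: gV_gdisjoint.
Qed.

Lemma edgeless_girth_infty :
  (forall u v w : vertex G, u <> v -> v <> w -> w <> u -> False) ->
  girth Gamma = None.
Proof.
move=> no3; apply: girth_infty => a b c ab bc ca.
have [a0 _] := set_valP a; have [b0 _] := set_valP b; have [c0 _] := set_valP c.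
have [u aE] := edgeless_vertex a0; have [v bE] := edgeless_vertex b0.
have [w cE] := edgeless_vertex c0.
apply: (no3 u v w) => uv; [move/eqP: ab | move/eqP: bc | move/eqP: ca]; apply.
- by apply: val_inj; rewrite aE bE uv.
- by apply: val_inj; rewrite bE cE uv.
- by apply: val_inj; rewrite cE aE uv.
Qed.

End Action.

(** * Cardinalities *)

Lemma card_geII_inj n (T : Type) :
  `I_n #<= [set: T] -> exists f : 'I_n -> T, injective f.
Proof.
move=> /card_leP[f].
exists (fun i : 'I_n => \val (f (SigSub (mem_set (ltn_ord i : `I_n i))))).
move=> i j /val_inj/inj; rewrite !in_setT => /(_ isT isT) /(congr1 val) /= ij.
exact: val_inj.
Qed.

Lemma card_eqII_inj n (T : Type) :
  [set: T] #= `I_n -> exists f : T -> 'I_n, injective f.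
Proof.
move=> /card_bijP[f /bij_inj f_inj].
pose g (x : T) := f (SigSub (mem_set (I : [set: T] x))).
exists (fun x => Ordinal (set_valP (g x))) => x y [] /val_inj/f_inj.
by move=> /(congr1 val).
Qed.

Lemma card_nat_cases (T : Type) n :
  [set: T] #= `I_n \/ (exists2 m, m < n & [set: T] #= `I_m) \/
  `I_n.+1 #<= [set: T].
Proof.
have [/finite_setP[m Tm]|/infiniteP leT] := pselect (finite_set [set: T]).
  case: (ltngtP m n) => [mn|nm|<-]; last by left.
    by right; left; exists m.
  by right; right; rewrite (card_le_eqr Tm) card_le_II.
by right; right; apply: card_le_trans leT; apply/subset_card_le.
Qed.

Unset Implicit Arguments.

(** * Classification by the numbers of edges and vertices *)

Theorem corollary5p10 (G : digraph) (nontriv : ~ trivial_digraph G) :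
  let Gamma := zero_divisor_graph (gis0 G) in
  [/\ [\/ (diam Gamma, girth Gamma) = (fin 1, infty),
          (diam Gamma, girth Gamma) = (fin 1, fin 3) |
          (diam Gamma, girth Gamma) = (fin 2, fin 3)],
      (diam Gamma, girth Gamma) = (fin 1, infty) <->
        [set: edge G] #= `I_0 /\ [set: vertex G] #= `I_2,
      (diam Gamma, girth Gamma) = (fin 1, fin 3) <->
        [set: edge G] #= `I_0 /\ `I_3 #<= [set: vertex G] &
      (diam Gamma, girth Gamma) = (fin 2, fin 3) <->
        ~ ([set: edge G] #= `I_0)].
Proof.
move=> Gamma.
have edgeless : [set: edge G] #= `I_0 -> edge G -> False.
  by move=> /card_eqII_inj[f _] e; case: (f e).
have case1 : [set: edge G] #= `I_0 /\ [set: vertex G] #= `I_2 ->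
    (diam Gamma, girth Gamma) = (fin 1, infty).
  move=> [E0 V2]; have no_edge := edgeless E0; congr pair.
    have /card_geII_inj[f f_inj] : `I_2 #<= [set: vertex G].
      by rewrite (card_le_eqr V2).
    by apply: (edgeless_diam no_edge (u := f ord0) (v := f ord_max)) => /f_inj.
  have [f f_inj] := card_eqII_inj V2.
  apply: (edgeless_girth_infty no_edge) => u v w uv vw wu.
  have f_neq x y : x <> y -> f x != f y by move=> xy; apply/eqP => /f_inj.
  (* Three distinct values cannot fit into ['I_2]. *)
  have := max_card [in [:: f u; f v; f w]].
  suff /card_uniqP-> : uniq [:: f u; f v; f w].
    by rewrite card_ord.
  by rewrite /= !inE negb_or !f_neq // => /esym.
have case2 : [set: edge G] #= `I_0 /\ `I_3 #<= [set: vertex G] ->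
    (diam Gamma, girth Gamma) = (fin 1, fin 3).
  move=> [E0 /card_geII_inj[f f_inj]]; have no_edge := edgeless E0; congr pair.
    by apply: (edgeless_diam no_edge (u := f ord0) (v := f ord_max)) => /f_inj.
  apply: (@edgeless_girth3 _ (f ord0) (f (inord 1)) (f ord_max));
    by move=> /f_inj/(congr1 val) /=; rewrite ?inordK.
have case3 : ~ ([set: edge G] #= `I_0) -> (diam Gamma, girth Gamma) = (fin 2, fin 3).
  move=> nE0; have [[e]|nE] := pselect (inhabited (edge G)).
    exact: diam_girth_edge.
  case: nE0; rewrite II0 card_eq0; apply/eqP/seteqP; split=> // e _.
  by case: nE.
have exhaust : [\/ [set: edge G] #= `I_0 /\ [set: vertex G] #= `I_2,
    [set: edge G] #= `I_0 /\ `I_3 #<= [set: vertex G] |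
    ~ ([set: edge G] #= `I_0)].
  have [E0|] := pselect (is_true ([set: edge G] #= `I_0)); last by constructor 3.
  (* Below two vertices, 0 contradicts non-emptiness and 1 makes the edgeless graph trivial. *)
  have [V2|[[[|[|//]] _ Vm]|V3]] := card_nat_cases (vertex G) 2.
  - by constructor 1.
  - have [v] := vertex_nonempty G.
    by have [f _] := card_eqII_inj Vm; case: (f v).
  - by case: nontriv.
  - by constructor 2.
(* The three conditions are exhaustive and their values pairwise different, so the implications
   proved above reverse. *)
by case: exhaust => [/[dup] h /case1 -> | /[dup] h /case2 -> | /[dup] h /case3 ->];
  split; try (by constructor); intuition congruence.
Qed.
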